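(* For every P-complete decision problem $L\subseteq\{0,1\}^*$, the flattened problem of $L$ can be computed by monotone circuits of at most polynomial size: there exist a polynomial $p$ and monotone Boolean circuits $C_n$ ($n\ge 0$) with $2n$ inputs and size at most $p(n)$ such that for all $w\in\{0,1\}^n$, $C_n(\mathrm{flat}(w))=1$ if and only if $w\in L$.
   Context: A monotone Boolean circuit is a Boolean circuit built only from AND and OR gates, with no NOT gates; its size is its number of gates. For $w=w_1\cdots w_n\in\{0,1\}^n$, $\mathrm{flat}(w)=\varphi(w_1)\cdots\varphi(w_n)$ with $\varphi(0)=10$, $\varphi(1)=01$. The flattened problem of $L$ is the language $\{\mathrm{flat}(w): w\in L\}$. P-completeness is with respect to deterministic logarithmic-space many-one reductions. *)

(* Defs.v *)
From HB Require Import structures.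
From mathcomp Require Import all_boot all_order all_algebra.

Set Implicit Arguments.
Unset Strict Implicit.
Unset Printing Implicit Defensive.

Definition language := seq bool -> Prop.

(* Tapes are infinite to the right only, with cells 0, 1, 2, ...; a left move
   from cell 0 leaves the head where it is. *)

Inductive move := Left | Stay | Right.

Definition move_head (d : move) (h : nat) : nat :=
  match d with Left => h.-1 | Stay => h | Right => h.+1 end.

Definition write (A : Type) (tape : nat -> A) (h : nat) (a : A) : nat -> A :=
  fun i => if i == h then a else tape i.

(* Deterministic single-tape Turing machines with input alphabet {0,1}. *)

Record machine := Machine {
  m_state : finType;
  m_symbol : finType;
  m_blank : m_symbol;
  m_bit : bool -> m_symbol;
  m_bit_inj : injective m_bit;
  m_bit_blank : forall b, m_bit b != m_blank;
  m_start : m_state;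
  m_accept : m_state;
  m_reject : m_state;
  m_accept_reject : m_accept != m_reject;
  m_delta : m_state -> m_symbol -> m_state * m_symbol * move }.

Record m_config (M : machine) := MConfig {
  mc_state : m_state M;
  mc_head : nat;
  mc_tape : nat -> m_symbol M }.

Definition m_init (M : machine) (w : seq bool) : m_config M :=
  MConfig (m_start M) 0 (nth (m_blank M) [seq m_bit M b | b <- w]).

Definition m_halted (M : machine) (c : m_config M) : bool :=
  (mc_state c == m_accept M) || (mc_state c == m_reject M).

(* Halting configurations are fixed points, so that "halts within t steps" means
   "is halted after t iterations". *)
Definition m_step (M : machine) (c : m_config M) : m_config M :=
  if m_halted c then c else
  let: (q, a, d) := m_delta (mc_state c) (mc_tape c (mc_head c)) in
  MConfig q (move_head d (mc_head c)) (write (mc_tape c) (mc_head c) a).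

Definition m_run (M : machine) (w : seq bool) (t : nat) : m_config M :=
  iter t (@m_step M) (m_init M w).

Definition decides_in_time (M : machine) (L : language) (T : nat -> nat) : Prop :=
  forall w : seq bool,
    m_halted (m_run M w (T (size w))) /\
    (mc_state (m_run M w (T (size w))) = m_accept M <-> L w).

Definition in_P (L : language) : Prop :=
  exists (M : machine) (p : {poly nat}),
    decides_in_time M L (fun n => p.[n]%R).

(* Transducers with a two-way read-only input tape, one work tape, and a one-way
   write-only output tape. *)

Inductive input_symbol := LeftEnd | Bit of bool | RightEnd.

Record action (Q A : Type) := Action {
  a_state : Q;
  a_input_move : move;
  a_write : A;
  a_work_move : move;
  a_output : option bool }.

Record transducer := Transducer {
  t_state : finType;
  t_symbol : finType;
  t_blank : t_symbol;
  t_start : t_state;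
  t_halt : t_state;
  t_delta : t_state -> input_symbol -> t_symbol -> action t_state t_symbol }.

Record t_config (M : transducer) := TConfig {
  tc_state : t_state M;
  tc_input_head : nat;
  tc_work_head : nat;
  tc_work : nat -> t_symbol M;
  tc_output : seq bool }.

(* Cell 0 of the input tape holds the left end marker, cells 1, ..., n the input,
   and cell n+1 the right end marker. *)
Definition input_tape (w : seq bool) : nat -> input_symbol :=
  nth RightEnd (LeftEnd :: [seq Bit b | b <- w]).

Definition t_init (M : transducer) : t_config M :=
  TConfig (t_start M) 0 0 (fun=> t_blank M) [::].

(* The input head is kept between the two end markers: were it allowed to roam
   beyond them, its position would be unbounded memory not charged as space. *)
Definition t_step (M : transducer) (w : seq bool) (c : t_config M) : t_config M :=
  if tc_state c == t_halt M then c else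
  let a := t_delta (tc_state c) (input_tape w (tc_input_head c))
                   (tc_work c (tc_work_head c)) in
  TConfig (a_state a)
    (minn (move_head (a_input_move a) (tc_input_head c)) (size w).+1)
    (move_head (a_work_move a) (tc_work_head c))
    (write (tc_work c) (tc_work_head c) (a_write a))
    (if a_output a is Some b then rcons (tc_output c) b else tc_output c).

Definition t_run (M : transducer) (w : seq bool) (t : nat) : t_config M :=
  iter t (t_step w) (t_init M).

Definition computes (M : transducer) (f : seq bool -> seq bool) : Prop :=
  forall w : seq bool, exists t : nat,
    tc_state (t_run M w t) = t_halt M /\ tc_output (t_run M w t) = f w.

(* Only work-tape cells count, and a cell is used when the head visits it. *)
Definition runs_in_space (M : transducer) (S : nat -> nat) : Prop :=
  forall (w : seq bool) (t : nat), tc_work_head (t_run M w t) < S (size w).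

(* The successor makes the O(log n) bound meaningful for n <= 1. *)
Definition logspace_computable (f : seq bool -> seq bool) : Prop :=
  exists (M : transducer) (k : nat),
    computes M f /\ runs_in_space M (fun n => k * (trunc_log 2 n).+1).

Definition logspace_reducible (K L : language) : Prop :=
  exists f : seq bool -> seq bool,
    logspace_computable f /\ forall w, K w <-> L (f w).

Definition P_complete (L : language) : Prop :=
  in_P L /\ forall K : language, in_P K -> logspace_reducible K L.

(* Monotone circuits with m inputs, as straight-line programs of fan-in-two
   gates: gate number k may read the inputs and the gates numbered less than k. *)

Inductive wire := Const of bool | Input of nat | Gate of nat.

Inductive gate := And of wire & wire | Or of wire & wire.

(* Constants are available only to circuits without inputs, which could not
   compute anything otherwise. *)
Definition wire_ok (m k : nat) (u : wire) : bool :=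
  match u with
  | Const _ => m == 0
  | Input i => i < m
  | Gate j => j < k
  end.

Definition gate_ok (m k : nat) (g : gate) : bool :=
  match g with And u v | Or u v => wire_ok m k u && wire_ok m k v end.

Fixpoint gates_ok (m k : nat) (gs : seq gate) : bool :=
  if gs is g :: gs' then gate_ok m k g && gates_ok m k.+1 gs' else true.

Record monotone_circuit (m : nat) := MonotoneCircuit {
  c_gates : seq gate;
  c_output : wire;
  c_gates_ok : gates_ok m 0 c_gates;
  c_output_ok : wire_ok m (size c_gates) c_output }.

Definition circuit_size (m : nat) (C : monotone_circuit m) : nat :=
  size (c_gates C).

(* x lists the values of the inputs and v those of the gates evaluated so far. *)
Definition wire_value (x v : seq bool) (u : wire) : bool :=
  match u with
  | Const b => b
  | Input i => nth false x i
  | Gate j => nth false v j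
  end.

Definition gate_value (x v : seq bool) (g : gate) : bool :=
  match g with
  | And u u' => wire_value x v u && wire_value x v u'
  | Or u u' => wire_value x v u || wire_value x v u'
  end.

Definition gate_values (x : seq bool) (gs : seq gate) : seq bool :=
  foldl (fun v g => rcons v (gate_value x v g)) [::] gs.

Definition circuit_eval (m : nat) (C : monotone_circuit m) (x : m.-tuple bool) : bool :=
  wire_value x (gate_values x (c_gates C)) (c_output C).

Definition flat (w : seq bool) : seq bool :=
  flatten [seq (if b then [:: false; true] else [:: true; false]) | b <- w].

Lemma size_flat (w : seq bool) : size (flat w) = 2 * size w.
Proof. by elim: w => //= b w IHw; rewrite size_cat IHw mulnS; case: b. Qed.

Lemma flat_tupleP (n : nat) (w : n.-tuple bool) : size (flat w) == 2 * n.
Proof. by rewrite size_flat size_tuple. Qed.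

Canonical flat_tuple (n : nat) (w : n.-tuple bool) : (2 * n).-tuple bool :=
  Tuple (flat_tupleP w).

(* Main.v *)
Require Import Defs.
From mathcomp Require Import all_boot all_order all_algebra.
From mathcomp Require Import zify.
From Stdlib Require Import IndefiniteDescription.

(** A configuration of a deterministic machine is encoded in one-hot form: one
    bit for each statement "the head is on cell i and the state is q" and one for
    each statement "cell i holds a".  Each bit of the next configuration is a
    disjunction, over all positions, states and scanned symbols, of conjunctions
    of unnegated bits, since exactly one such triple describes the current
    configuration.  Negations occur only in the initial configuration, where they
    are applied to input bits, and there flattening supplies them. *)

Set Implicit Arguments.
Unset Strict Implicit.
Unset Printing Implicit Defensive.

(** * Appending gates, and the bits of a flattened word *)

Lemma gates_ok_rcons m k gs g :
  gates_ok m k (rcons gs g) = gates_ok m k gs && gate_ok m (k + size gs) g.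
Proof.
elim: gs k => [|g' gs IHgs] k /=; first by rewrite addn0 andbT.
by rewrite IHgs addSnnS andbA.
Qed.

Lemma gate_values_rcons x gs g :
  gate_values x (rcons gs g) =
  rcons (gate_values x gs) (gate_value x (gate_values x gs) g).
Proof. by rewrite /gate_values foldl_rcons. Qed.

Lemma size_gate_values x gs : size (gate_values x gs) = size gs.
Proof.
elim/last_ind: gs => // gs g IHgs.
by rewrite gate_values_rcons !size_rcons IHgs.
Qed.

Lemma nth_flat (w : seq bool) i : i < size w ->
  nth false (flat w) i.*2 = ~~ nth false w i /\
  nth false (flat w) i.*2.+1 = nth false w i.
Proof.
elim: w i => // b w IHw [_|i lt_iw]; first by case: b.
by by have [e0 e1] := IHw i lt_iw; case: b {lt_iw}; rewrite /= e0 e1.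
Qed.

(** * Joint computation by monotone gates on flattened inputs *)

Section FlatCircuits.

Variable n : nat.
Implicit Types (gs : seq gate) (f : n.-tuple bool -> bool).
Implicit Types (F : (n.-tuple bool -> bool) -> Prop).

Definition realizes gs f := exists2 u, wire_ok (2 * n) (size gs) u &
  forall w : n.-tuple bool, wire_value (flat w) (gate_values (flat w) gs) u = f w.

(** One gate list serves the whole class [F], so each tableau row is built once and shared;
    unfolding every bit separately would multiply the size at each step. *)
Definition jointly_computable k F := exists gs,
  [/\ gates_ok (2 * n) 0 gs, size gs <= k & forall f, F f -> realizes gs f].

Definition adjoin F f h := F h \/ h =1 f.

Lemma realizes_eq gs f g : f =1 g -> realizes gs g -> realizes gs f.
Proof. by move=> eq_fg [u ok_u uE]; exists u => // w; rewrite uE eq_fg. Qed.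

Lemma realizes_rcons gs f g : realizes gs f -> realizes (rcons gs g) f.
Proof.
case=> u ok_u uE; exists u.
  by rewrite size_rcons; case: u ok_u {uE} => //= j /ltnW.
move=> w; rewrite -uE gate_values_rcons; case: u ok_u {uE} => //= j lt_j.
by rewrite nth_rcons size_gate_values lt_j.
Qed.

Lemma realizes_last gs g : realizes (rcons gs g)
  (fun w : n.-tuple bool => gate_value (flat w) (gate_values (flat w) gs) g).
Proof.
exists (Gate (size gs)) => [|w]; first by rewrite /= size_rcons.
by rewrite /= gate_values_rcons nth_rcons size_gate_values ltnn eqxx.
Qed.

Lemma jointly_sub k k' F F' : k <= k' -> (forall f, F' f -> F f) ->
  jointly_computable k F -> jointly_computable k' F'.
Proof.
move=> le_k sF [gs [ok le_gs rF]]; exists gs.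
by split=> //; [apply: leq_trans le_k | move=> f /sF/rF].
Qed.

Lemma jointly_gate k F f g (op : wire -> wire -> gate) (b : bool -> bool -> bool) :
  (forall m i u v, gate_ok m i (op u v) = wire_ok m i u && wire_ok m i v) ->
  (forall x y u v, gate_value x y (op u v) = b (wire_value x y u) (wire_value x y v)) ->
  F f -> F g -> jointly_computable k F ->
  jointly_computable k.+1 (adjoin F (fun w => b (f w) (g w))).
Proof.
move=> opok opE Ff Fg [gs [ok le_gs rF]].
have [[u oku uE] [v okv vE]] := (rF _ Ff, rF _ Fg).
exists (rcons gs (op u v)); split; last 1 first.
- move=> h [/rF|eq_h]; first exact: realizes_rcons.
  by apply: realizes_eq (realizes_last gs (op u v)) => w; rewrite eq_h opE uE vE.
- by rewrite gates_ok_rcons ok opok oku okv.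
- by rewrite size_rcons.
Qed.

Lemma jointly_and k F f g : F f -> F g -> jointly_computable k F ->
  jointly_computable k.+1 (adjoin F (fun w => f w && g w)).
Proof. exact: (@jointly_gate k F f g And). Qed.

Lemma jointly_or k F f g : F f -> F g -> jointly_computable k F ->
  jointly_computable k.+1 (adjoin F (fun w => f w || g w)).
Proof. exact: (@jointly_gate k F f g Or). Qed.

(** Each term costs two [And] gates and one [Or] gate joining it to the partial disjunction. The
    empty disjunction is taken from [F], since constant wires may be forbidden. *)
Lemma jointly_dnf (I : Type) (s : seq I) (a b c : I -> n.-tuple bool -> bool) k F :
  F (fun=> false) -> (forall z, F (a z)) -> (forall z, F (b z)) ->
  (forall z, F (c z)) -> jointly_computable k F ->
  jointly_computable (k + 3 * size s)
    (adjoin F (fun w => has (fun z => [&& a z w, b z w & c z w]) s)).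
Proof.
move=> F0 Fa Fb Fc cF; elim: s => [|z s IHs] /=.
  have [gs [ok le_gs rF]] := cF; exists gs; rewrite muln0 addn0; split=> // f [/rF//|eq_f].
  exact: realizes_eq eq_f (rF _ F0).
have c1 := jointly_and (or_introl (Fb z)) (or_introl (Fc z)) IHs.
have c2 := jointly_and (or_introl (or_introl (Fa z))) (or_intror (frefl _)) c1.
have c3 := jointly_or (or_intror (frefl _)) (or_introl (or_introl (or_intror (frefl _)))) c2.
apply: jointly_sub c3; first by lia.
by move=> f [Ff|eq_f]; [do 3!left; left | right].
Qed.

(** The extension hypothesis ranges over all larger classes [F'] because functions adjoined earlier
    enlarge the class before the next one is built. *)
Lemma jointly_family (J : eqType) (r : seq J) (f : J -> n.-tuple bool -> bool) k d F :
  (forall j k' F', (forall g, F g -> F' g) -> jointly_computable k' F' ->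
     jointly_computable (k' + d) (adjoin F' (f j))) ->
  jointly_computable k F ->
  jointly_computable (k + size r * d)
    (fun h => F h \/ exists2 j, j \in r & h =1 f j).
Proof.
move=> ext cF; elim: r => [|j r IHr] /=.
  by rewrite addn0; apply: jointly_sub cF => // h [|[]].
have := ext j _ _ (fun g Fg => or_introl Fg) IHr.
apply: jointly_sub => [|h [Fh|[i]]]; first by lia.
  by do 2!left.
by rewrite inE => /predU1P[->|ir] eq_h; [right | left; right; exists i].
Qed.

(** The arbitrary [c] covers negation; the separate constant case serves blank cells, initial head
    bits and [n = 0]. *)
Definition literal f :=
  (exists b, f =1 fun=> b) \/
  exists i (c : bool -> bool), i < n /\ f =1 (fun w => c (nth false w i)).

(* Constant wires are forbidden when n > 0; there, x_0 and its flattened negation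
   give the constants as x_0 || ~~ x_0 and x_0 && ~~ x_0. *)
Lemma jointly_literals : jointly_computable 2 literal.
Proof.
have [gs [ok le_gs rb]] : exists gs, [/\ gates_ok (2 * n) 0 gs, size gs <= 2 &
    forall b, realizes gs (fun=> b)].
  have [n0|n_gt0] := posnP n.
    by exists [::]; split=> // b; exists (Const b) => //=; rewrite n0.
  have x01 (w : n.-tuple bool) : nth false (flat w) 0 = ~~ nth false (flat w) 1.
    by have := @nth_flat w 0; rewrite size_tuple => /(_ n_gt0) [-> ->].
  exists [:: And (Input 0) (Input 1); Or (Input 0) (Input 1)].
  split=> // [|b]; first by rewrite /=; lia.
  (* [b] is read as a number: gate 0, the conjunction, is false and gate 1, the disjunction, is
     true. *)
  exists (Gate b) => [|w]; first by case: b.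
  by case: b; rewrite /= x01 ?orNb ?andNb.
exists gs; split=> // f [[b eq_f]|[i [c [lt_in eq_f]]]].
  exact: realizes_eq eq_f (rb b).
apply: realizes_eq eq_f _.
have xE (w : n.-tuple bool) := @nth_flat w i.
(* In order, [c] is constantly true, the identity, negation, constantly false. *)
have [ct|ct] := boolP (c true); have [cf|cf] := boolP (c false).
- apply: realizes_eq (rb true) => w; by case: nth.
- exists (Input i.*2.+1) => [|w]; first by rewrite /=; lia.
  rewrite /= (xE w _).2 ?size_tuple //; case: nth => //; exact/esym/negbTE.
- exists (Input i.*2) => [|w]; first by rewrite /=; lia.
  rewrite /= (xE w _).1 ?size_tuple //; case: nth => //; exact/esym/negbTE.
- apply: realizes_eq (rb false) => w; case: nth; exact/negbTE.
Qed.

Lemma jointly_circuit k F f : jointly_computable k F -> F f ->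
  exists C : monotone_circuit (2 * n),
    circuit_size C <= k /\ forall w : n.-tuple bool, circuit_eval C (flat_tuple w) = f w.
Proof.
case=> gs [ok le_gs rF] /rF[u ok_u uE].
by exists (MonotoneCircuit ok ok_u).
Qed.

End FlatCircuits.

(** * Simulation of a Turing machine by tableau rows *)

Section Tableau.

Variable M : machine.
Notation Q := (m_state M).
Notation A := (m_symbol M).

(** Staying put and rewriting the scanned symbol turns the fixed points of [m_step] into ordinary
    transitions. *)
Definition total_delta (q : Q) (a : A) : Q * A * move :=
  if (q == m_accept M) || (q == m_reject M) then (q, a, Stay) else m_delta q a.

Definition config_bit N (c : m_config M) (j : 'I_N * (Q + A)) : bool :=
  match j with
  | (i, inl q) => (mc_head c == i) && (mc_state c == q)
  | (i, inr a) => mc_tape c i == a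
  end.

(* The value of bit j after the step, provided that z = (h, q, b) gives the
   head position, the state and the scanned symbol of c before the step. *)
Definition next_bit N (c : m_config M) (z : 'I_N * Q * A) (j : 'I_N * (Q + A)) : bool :=
  let: (h, q, b) := z in
  let: (q', b', d) := total_delta q b in
  match j with
  | (i, inl q1) => (move_head d h == i) && (q' == q1)
  | (i, inr a) => if i == h then b' == a else config_bit c j
  end.

(** Only the triple [z0] describing [c] passes both tests, so the disjunction collapses to its term;
    the bound on the head makes [z0] one of the indices. *)
Lemma config_bit_step N (c : m_config M) (j : 'I_N * (Q + A)) : mc_head c < N ->
  config_bit (m_step c) j =
  has (fun z : 'I_N * Q * A => [&& config_bit c (z.1.1, inl z.1.2),
         config_bit c (z.1.1, inr z.2) & next_bit c z j])
      (enum {: 'I_N * Q * A}).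
Proof.
move=> lt_hN; pose z0 := (Ordinal lt_hN, mc_state c, mc_tape c (mc_head c)).
transitivity (next_bit c z0 j).
  rewrite /next_bit /total_delta /z0 /m_step /m_halted.
  case: ifP => _; case: j => i [q|a] //=.
  - by rewrite -val_eqE /=; case: (_ =P mc_head c) => [->|].
  - by case: m_delta => [[q' b'] d].
  - case: m_delta => [[q' b'] d] /=; rewrite /write -val_eqE /=.
    by case: ifP.
apply/idP/hasP => [nz0|[[[h q] b] _ /and3P[/andP[/eqP/= eh /eqP eq] /eqP eb]]].
  by exists z0; [rewrite mem_enum | apply/and3P; rewrite /= !eqxx].
by rewrite /z0 (_ : Ordinal lt_hN = h) ?eq ?eh ?eb //; apply: val_inj.
Qed.

Lemma m_head_run w t : mc_head (m_run M w t) <= t.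
Proof.
elim: t => //= t; rewrite -/(m_run M w t) /m_step.
case: ifP => _ le_h; first exact: leqW.
by case: m_delta => [[q a] []] /=; lia.
Qed.

(** Literals stay in every row so that the constants needed to build the next row remain at hand. *)
Definition tableau_row n N t (f : n.-tuple bool -> bool) :=
  literal f \/
  exists j : 'I_N * (Q + A), f =1 fun w => config_bit (m_run M w t) j.

Definition row_cost N := #|{: 'I_N * (Q + A)}| * (3 * #|{: 'I_N * Q * A}|).

Lemma tableau_row0 n N (f : n.-tuple bool -> bool) : tableau_row N 0 f -> literal f.
Proof.
case=> // -[[i [q|a]] eq_f].
  by left; exists ((0 == i) && (m_start M == q)).
have [lt_in|le_ni] := ltnP i n; last first.
  left; exists (m_blank M == a) => w.
  by rewrite eq_f /= nth_default // size_map size_tuple.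
right; exists (nat_of_ord i), (fun b => m_bit M b == a); split=> // w.
by rewrite eq_f /= (nth_map false) // size_tuple.
Qed.

Lemma jointly_tableau_row n N t : t <= N ->
  jointly_computable (2 + t * row_cost N) (@tableau_row n N t).
Proof.
elim: t => [_|t IHt lt_tN].
  exact: jointly_sub (@tableau_row0 n N) (jointly_literals n).
pose bit j (w : n.-tuple bool) := @config_bit N (m_run M w t.+1) j.
have := @jointly_family n _ (enum {: 'I_N * (Q + A)}) bit _
  (3 * #|{: 'I_N * Q * A}|) _ _ (IHt (ltnW lt_tN)).
rewrite -cardE -/(row_cost N) => cst; apply: jointly_sub (cst _) => [|f|].
- by rewrite mulSn addnCA addnC.
- case=> [lf|[j eq_f]]; first by left; left.
  by right; exists j; rewrite ?mem_enum.
move=> j k F sF cF.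
have cbit z : F (fun w => @config_bit N (m_run M w t) z) by apply: sF; right; exists z.
have lit b : F (fun=> b) by apply: sF; left; left; exists b.
have := @jointly_dnf n _ (enum {: 'I_N * Q * A})
  (fun z w => config_bit (m_run M w t) (z.1.1, inl z.1.2))
  (fun z w => config_bit (m_run M w t) (z.1.1, inr z.2))
  (fun z w => next_bit (m_run M w t) z j) k F (lit _) (fun z => cbit _) (fun z => cbit _).
rewrite -cardE => dnf; apply: jointly_sub (dnf _ cF) => // [f [|eq_f]|[[h q] b]].
- by left.
- right=> w; rewrite eq_f /bit /= -/(m_run M w t) config_bit_step //.
  exact: leq_ltn_trans (m_head_run w t) lt_tN.
(* For fixed [z] and [j], [next_bit] is a constant or the bit of an untouched cell in row [t], so no
   negation arises. *)
- rewrite /next_bit; case: total_delta => [[q' b'] d].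
  case: j {dnf} => i [q1|a]; first exact: lit.
  by case: (i == h); [apply: lit | apply: cbit].
Qed.

Lemma jointly_accept n T :
  jointly_computable (2 + T * row_cost T.+1 + 3 * T.+1)
    (fun f : n.-tuple bool -> bool =>
       f =1 fun w => mc_state (m_run M w T) == m_accept M).
Proof.
have cT := @jointly_tableau_row n T.+1 T (leqnSn T).
pose acc (i : 'I_T.+1) (w : n.-tuple bool) :=
  config_bit (m_run M w T) (i, inl (m_accept M)).
have Facc i : tableau_row T.+1 T (acc i).
  by right; exists (i, inl (m_accept M)).
(* Acceptance is a disjunction over the [T + 1] cells the head can occupy; [acc] is repeated to fill
   the three conjuncts. *)
have := @jointly_dnf n _ (enum 'I_T.+1) acc acc acc _ _ _ Facc Facc Facc cT.
rewrite -cardE card_ord => dnf; apply: jointly_sub (dnf _) => // [f eq_f|]; last first.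
  by left; left; exists false.
right=> w; rewrite eq_f /acc /=; apply/idP/hasP => [qa|[i _ /andP[/andP[] //]]].
have lt_h : mc_head (m_run M w T) < T.+1 by apply: m_head_run.
by exists (Ordinal lt_h); rewrite ?mem_enum //= eqxx qa.
Qed.

End Tableau.

Theorem theorem6 (L : language) (hL : P_complete L) :
  exists (p : {poly nat}) (C : forall n : nat, monotone_circuit (2 * n)),
    forall n : nat,
      circuit_size (C n) <= (p.[n])%R /\
      forall w : n.-tuple bool, circuit_eval (C n) (flat_tuple w) <-> L w.
Proof.
have [[M [p decM]] _] := hL.
pose q := #|m_state M|; pose a := #|m_symbol M|; pose r : {poly nat} := (p + 1)%R.
(* The gate count of [jointly_accept] at [T = p(n)]: [r] counts cells, [q + a] bits per cell, and
   [r * q * a] scanned triples. *)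
pose s : {poly nat} :=
  (2%:P + p * (r * (q + a)%:P * (3%:P * (r * q%:P * a%:P))) + 3%:P * r)%R.
have sizeC (n : nat) : 2 + p.[n]%R * row_cost M p.[n]%R.+1 + 3 * p.[n]%R.+1 = s.[n]%R.
  rewrite /row_cost !(card_prod, card_sum) card_ord /s /r.
  by rewrite !(hornerD, hornerM, hornerC) -(addn1 p.[n]%R).
have exC (n : nat) : exists C : monotone_circuit (2 * n),
    circuit_size C <= s.[n]%R /\
    forall w : n.-tuple bool, circuit_eval C (flat_tuple w) <-> L w.
  have [C [leC evalC]] := jointly_circuit (jointly_accept M n p.[n]%R) (frefl _).
  exists C; rewrite -sizeC; split=> // w; rewrite evalC.
  have [_] := decM w; rewrite size_tuple => <-.
  by split=> /eqP.
(* Indefinite description selects one circuit for each [n]. *)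
exists s, (fun n => sval (constructive_indefinite_description _ (exC n))) => n.
by case: constructive_indefinite_description.
Qed.
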